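(* Let $r\ge2$ be an integer and let $G_n=(V_n,E_n)$, $n\in\mathbb{N}$, be a sequence of $r$-regular bipartite graphs with $\#V_n\to\infty$. Then for all $p\in[0,1]$, $$h_{\{G_n\}}(p)\le\min\big(\mathrm{upp}_{r,1}(p),\mathrm{upp}_{r,2}(p)\big),$$ where $$\mathrm{upp}_{r,1}(p):=\frac{p\log r!}{2r}-\tfrac12p\log p-(1-p)\log(1-p),\qquad \mathrm{upp}_{r,2}(p):=\frac{p\log r}{2}-\tfrac12\big(p\log p+(1-p)\log(1-p)\big).$$
   Context: For a finite graph $G$, $\phi(l,G)$ is the number of sets of $l$ pairwise vertex-disjoint edges. For a sequence of finite graphs $G_n=(V_n,E_n)$ with $\#V_n\to\infty$, $h_{\{G_n\}}(p)$ is the supremum, over all sequences of nonnegative integers $l_n$ with $\lim_n 2l_n/\#V_n=p$, of $\limsup_{n\to\infty}\frac{\log\phi(l_n,G_n)}{\#V_n}$ (with $\log 0=-\infty$). Convention: $0\log0=0$. *)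

(* Defs.v *)
From HB Require Import structures.
From mathcomp Require Import all_boot all_order all_algebra.
From mathcomp Require Import all_classical all_reals all_analysis.

Set Implicit Arguments.
Unset Strict Implicit.
Unset Printing Implicit Defensive.

Import Order.TTheory GRing.Theory Num.Theory.
Import numFieldNormedType.Exports.

Local Open Scope ring_scope.

(* Graphs are simple: an edge is a two-element set of vertices. *)
Record simple_graph := SimpleGraph {
  vertex :> finType;
  edges : {set {set vertex}};
  card_edge : forall e : {set vertex}, e \in edges -> #|e| = 2%N }.

Definition degree (G : simple_graph) (v : G) : nat :=
  #|[set e in edges G | v \in e]|.

Definition is_regular (r : nat) (G : simple_graph) : Prop :=
  forall v : G, degree v = r.

Definition is_bipartite (G : simple_graph) : Prop :=
  exists A : {set G}, forall e : {set G}, e \in edges G ->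
    ~~ (e \subset A) /\ ~~ (e \subset ~: A)%SET.

Definition is_matching (G : simple_graph) (M : {set {set G}}) : bool :=
  (M \subset edges G) && finset.trivIset M.

Definition phi (l : nat) (G : simple_graph) : nat :=
  #|[set M : {set {set G}} | is_matching M & #|M| == l]|.

Local Open Scope classical_set_scope.

Definition has_density (R : realType) (G : nat -> simple_graph) (p : R)
    (l : nat -> nat) : Prop :=
  (fun n => (2 * l n)%:R / #|G n|%:R : R) @ \oo --> p.

(* [lne] is the extended logarithm, with [lne 0 = -oo]. *)
Definition entropy_along (R : realType) (G : nat -> simple_graph) (l : nat -> nat)
    : \bar R :=
  limn_esup (fun n =>
    (lne (phi (l n) (G n))%:R%:E / (#|G n|%:R : R)%:E)%E).

Definition matching_entropy (R : realType) (G : nat -> simple_graph) (p : R) : \bar R :=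
  ereal_sup [set entropy_along R G l | l in has_density G p].

(* [ln 0 = 0], so the convention [0 log 0 = 0] is built in. *)
Definition upp1 (R : realType) (r : nat) (p : R) : R :=
  p * ln (r`!)%:R / (2 * r%:R) - 2^-1 * (p * ln p) - (1 - p) * ln (1 - p).

Definition upp2 (R : realType) (r : nat) (p : R) : R :=
  p * ln r%:R / 2 - 2^-1 * (p * ln p + (1 - p) * ln (1 - p)).

(* Main.v *)
Require Import Defs.
From HB Require Import structures.
From mathcomp Require Import all_boot all_order all_algebra all_fingroup.
From mathcomp Require Import all_classical all_reals all_analysis.
From mathcomp Require Import ring lra.

Import Order.TTheory GRing.Theory Num.Theory.
Import numFieldNormedType.Exports.

Local Open Scope ring_scope.
Local Open Scope classical_set_scope.

(* Let both sides of an [r]-regular bipartite graph have [n] vertices. An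
   [l]-matching is a choice of an [l]-subset [X] of one side together with a
   matching saturating [X]. There are at most [r^l] of the latter, which gives
   [upp2]. Adding [n - l] all-ones rows to the biadjacency matrix restricted to
   [X] and applying Bregman's bound on permanents, there are also at most
   [(r!)^(l/r) (n!)^((n-l)/n) / (n-l)!] of them; since [(n!)^(1/n) / n] is
   nonincreasing, this is at most [(r!)^(l/r) (1 - q)^(-(n-l))] with [q = l/n].
   With ['C(n, l) <= q^(-l) (1 - q)^(-(n-l))] both bounds hold for every finite
   graph without error term, and the theorem follows by continuity of [upp1] and
   [upp2]. *)

(** * Bregman's inequality *)

Lemma ln_le_sub1 {R : realType} (t : R) : 0 < t -> ln t <= t - 1.
Proof.
move=> t0; have := @le_ln1Dx R (t - 1); rewrite (addrC 1) subrK; apply.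
by rewrite ltrBrDr addNr.
Qed.

(** Convexity of [x ln x]: [ln t <= t - 1] is applied with [t] the mean divided by [x i], and the
    resulting error terms sum to zero. *)
Lemma log_sum_card {R : realType} (I : finType) (A : {set I}) (x : I -> R) :
  (forall i, i \in A -> 0 <= x i) ->
  (\sum_(i in A) x i) * ln (\sum_(i in A) x i)
  <= (\sum_(i in A) x i) * ln #|A|%:R + \sum_(i in A) x i * ln (x i).
Proof.
move=> x0; set S := \sum_(i in A) x i.
have S0 : 0 <= S by apply: sumr_ge0.
have [SE|Sn0] := eqVneq S 0.
  rewrite SE !mul0r add0r sumr_ge0// => i Ai.
  by rewrite (psumr_eq0P x0 SE)// mul0r.
have Sp : 0 < S by rewrite lt0r Sn0.
have A0 : (0 < #|A|)%N.
  rewrite lt0n; apply: contra Sn0 => /eqP/cards0_eq A0.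
  by rewrite /S A0 big_set0.
have Ap : 0 < #|A|%:R :> R by rewrite ltr0n.
have : \sum_(i in A) x i * (ln S - ln #|A|%:R - ln (x i))
       <= \sum_(i in A) (S / #|A|%:R - x i).
  apply: ler_sum => i Ai; have := x0 i Ai; rewrite le_eqVlt => /predU1P[<-|xi].
    by rewrite mul0r subr0 divr_ge0.
  rewrite -!ln_div ?posrE ?divr_gt0//.
  have := ln_le_sub1 (S / #|A|%:R / x i) ltac:(by rewrite !divr_gt0).
  move=> /(ler_wpM2l (ltW xi)) /le_trans; apply.
  by rewrite mulrBr mulr1 (mulrC (x i)) divfK ?gt_eqF.
rewrite sumrB sumr_const -/S -(mulr_natr (_ / _)) divfK ?gt_eqF// subrr.
under eq_bigr do rewrite mulrBr.
by rewrite sumrB -mulr_suml -/S mulrBr; lra.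
Qed.

Definition perms {n} (a : rel 'I_n) : {set 'S_n} := [set s : 'S_n | [forall i, a i (s i)]]%SET.

Definition minor {n} (a : rel 'I_n.+1) (i k : 'I_n.+1) : rel 'I_n :=
  fun i' k' => a (lift i i') (lift k k').

Lemma lift_permP {n} (i : 'I_n.+1) (s : 'S_n.+1) :
  exists s' : 'S_n, s = lift_perm i (s i) s'.
Proof.
(* The default of [odflt] is never reached, since [s (lift i k)] differs from [s i] by
   injectivity. *)
pose g k := odflt k (unlift (s i) (s (lift i k))).
have gK k : lift (s i) (g k) = s (lift i k).
  rewrite /g; have := neq_lift i k.
  by rewrite -(can_eq (permK s)) => /unlift_some[] ? ? ->.
have g_inj : injective g.
  by move=> k k' /(congr1 (lift (s i))); rewrite !gK => /perm_inj/lift_inj.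
exists (perm g_inj); apply/permP => k.
by case: (unliftP i k) => [k'|] ->; rewrite ?lift_perm_id// lift_perm_lift permE gK.
Qed.

Lemma card_perms_minor {n} (a : rel 'I_n.+1) i k :
  (#|[set s in perms a | s i == k]%SET| <= #|perms (minor a i k)|)%N.
Proof.
apply: leq_trans (leq_imset_card (lift_perm i k) _); apply: subset_leq_card.
apply/fintype.subsetP => s; rewrite !inE => /andP[/forallP sa /eqP sik].
have [s' sE] := lift_permP i s; apply/imsetP; exists s'; last by rewrite -sik.
by rewrite inE; apply/forallP => j; rewrite /minor -sik -(lift_perm_lift i) -sE.
Qed.

Lemma card_minor_row {n} (a : rel 'I_n.+1) (i k : 'I_n.+1) (j : 'I_n) :
  #|[set k' | minor a i k j k']%SET| =
  (#|[set k' | a (lift i j) k']%SET| - a (lift i j) k)%N.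
Proof.
rewrite -(card_imset _ (@lift_inj _ k)) [in RHS](cardsD1 k) inE.
rewrite addKn; apply: eq_card => k'; rewrite !inE.
apply/imsetP/andP => [[l]|[kk' ak']].
  by rewrite inE => al ->; rewrite eq_sym neq_lift.
by case: (unliftP k k') kk' ak' => [l ->|->]; rewrite ?eqxx// => _ al; exists l; rewrite ?inE.
Qed.

(* Zero at [d = 0], since [x / 0 = 0]. *)
Definition ln_fact_avg {R : realType} (d : nat) : R := ln d`!%:R / d%:R.

Lemma ln_fact_avgE {R : realType} d : d%:R * ln_fact_avg d = ln d`!%:R :> R.
Proof.
case: d => [|d]; first by rewrite mul0r fact0 ln1.
by rewrite /ln_fact_avg mulrC divfK ?pnatr_eq0.
Qed.

(* Schrijver's proof: apply [log_sum_card] to the expansion of the permanent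
   along every row, and the induction hypothesis to the minors that occur. *)
Theorem bregman {R : realType} n (a : rel 'I_n) : (0 < #|perms a|)%N ->
  ln #|perms a|%:R <= \sum_i ln_fact_avg #|[set k | a i k]%SET| :> R.
Proof.
elim: n a => [|n IH] a S0.
  rewrite big_ord0 ln_le0// -[leRHS]/(1%:R) ler_nat.
  by apply: leq_trans (max_card _) _; rewrite card_Sn.
set S := perms a in S0 *; pose r i := #|[set k | a i k]%SET|.
pose P i k := #|[set s in S | s i == k]%SET|.
have Sa s i : s \in S -> a i (s i) by rewrite inE => /forallP.
have sumP i (F : 'I_n.+1 -> R) :
    \sum_(s in S) F (s i) = \sum_(k in [set k | a i k]%SET) (P i k)%:R * F k.
  rewrite (partition_big (fun s : 'S_n.+1 => s i) (mem [set k | a i k]%SET))/=; last first.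
    by move=> s /(Sa _ i); rewrite inE.
  apply: eq_bigr => k _.
  under eq_bigr => s /andP[_ /eqP ->] do over.
  rewrite sumr_const -(mulr_natl (F k)); congr (_%:R * _).
  by apply: eq_card => s; rewrite [RHS]inE.
have sum1 i : #|S|%:R = \sum_(k in [set k | a i k]%SET) (P i k)%:R :> R.
  have := sumP i (fun=> 1); rewrite sumr_const => ->.
  by apply: eq_bigr => k _; rewrite mulr1.
have r0 i : (0 < r i)%N.
  by have /card_gt0P[s /(Sa _ i) ai] := S0; apply/card_gt0P; exists (s i); rewrite inE.
(* Convexity along row [i]; grouping permutations by their value at [i] turns the terms [P ln P]
   into a sum over [S]. *)
have logsum i : #|S|%:R * ln #|S|%:R <= #|S|%:R * ln (r i)%:R
    + \sum_(s in S) ln (P i (s i))%:R :> R.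
  rewrite (sumP i (fun k => ln (P i k)%:R)) (sum1 i).
  by apply: log_sum_card.
have IHs s i : s \in S -> ln (P i (s i))%:R
    <= \sum_(j | j != i) ln_fact_avg (r j - a j (s i)) :> R.
  move=> sS; have P0 : (0 < P i (s i))%N.
    by apply/card_gt0P; exists s; rewrite inE sS eqxx.
  have PM := card_perms_minor a i (s i).
  apply: (@le_trans _ _ (ln #|perms (minor a i (s i))|%:R)).
    by rewrite ler_ln ?posrE ?ltr0n ?ler_nat// (leq_trans P0).
  apply: le_trans (IH _ (leq_trans P0 PM)) _.
  under eq_bigr do rewrite card_minor_row.
  rewrite le_eqVlt; apply/orP; left; apply/eqP; symmetry.
  (* Inverting [lift i] takes a default element of ['I_n], hence the separate case [n = 0]. *)
  have [n0|n0] := posnP n.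
    have ord0' (k : 'I_n.+1) : k = 0%N :> nat by case: k => -[|m]//=; rewrite n0.
    rewrite !big1// => j; first by have := ltn_ord j; rewrite {2}n0.
    by move=> /eqP[]; apply: ord_inj; rewrite !ord0'.
  rewrite (reindex (lift i)); last first.
    exists (fun k => odflt (Ordinal n0) (unlift i k)) => k; first by rewrite liftK.
    by rewrite inE eq_sym => /unlift_some[k' -> ->].
  by apply: eq_bigl => k; rewrite eq_sym neq_lift.
(* Indexed by the columns [s i], the sum has [r j - 1] terms in which row [j] loses an entry and
   [n.+1 - r j] in which it does not. The former add up to [ln (r j - 1)!], which [ln (r j)]
   completes to [ln (r j)!]. *)
have colsum s j : s \in S -> ln (r j)%:R
     + \sum_(i | j != i) ln_fact_avg (r j - a j (s i)) = n.+1%:R * ln_fact_avg (r j) :> R.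
  move=> sS; rewrite (reindex_inj (@perm_inj _ s^-1))/=.
  under eq_bigr do rewrite permKV.
  transitivity (ln (r j)%:R + (\sum_(k | a j k && (s j != k)) ln_fact_avg (r j).-1
      + \sum_(k | ~~ a j k) ln_fact_avg (r j)) : R).
    congr (_ + _); rewrite (bigID (a j))/=; congr (_ + _).
      apply: eq_big => k; first by rewrite andbC -(inj_eq (@perm_inj _ s) j) permKV.
      by move=> /andP[_ ->]; rewrite subn1.
    apply: eq_big => k.
      case ajk: (a j k); rewrite /= ?andbF// andbT.
      by apply/eqP => jk; move: (Sa s j sS); rewrite {2}jk permKV ajk.
    by move=> /andP[_ /negbTE ->]; rewrite subn0.
  rewrite !sumr_const -2!(mulr_natl (ln_fact_avg _)).
  have -> : #|[pred k | a j k && (s j != k)]| = (r j).-1.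
    rewrite /r (cardsD1 (s j)) inE Sa//=.
    by apply: eq_card => k; rewrite !inE andbC eq_sym.
  have -> : #|[pred k | ~~ a j k]| = (n.+1 - r j)%N.
    rewrite -(addKn (r j) #|_|); congr (_ - _)%N.
    rewrite -[RHS]card_ord -(cardsC [set k | a j k]%SET); congr (_ + _)%N.
    by apply: eq_card => k; rewrite !inE.
  rewrite ln_fact_avgE natrB; last by rewrite -[leqRHS]card_ord max_card.
  rewrite mulrBl ln_fact_avgE -[in RHS](prednK (r0 j)) -[in ln (r j)`!%:R](prednK (r0 j)).
  rewrite factS natrM lnM ?posrE ?ltr0n ?fact_gt0// !prednK//.
  by lra.
have Sp : 0 < #|S|%:R :> R by rewrite ltr0n.
have np : 0 < n.+1%:R :> R by [].
(* The factor [n.+1] provides one copy of [#|S| ln #|S|] for each row to be expanded. *)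
rewrite -(ler_pM2l np) -(ler_pM2l Sp).
have -> : #|S|%:R * (n.+1%:R * ln #|S|%:R) = \sum_(i < n.+1) #|S|%:R * ln #|S|%:R :> R.
  by rewrite sumr_const card_ord -[RHS]mulr_natl; ring.
apply: le_trans (ler_sum _ (fun i _ => logsum i)) _.
rewrite big_split/= exchange_big/=.
apply: (@le_trans _ _ (\sum_(s in S) \sum_j (ln (r j)%:R
   + \sum_(i | j != i) ln_fact_avg (r j - a j (s i))))).
  under [leRHS]eq_bigr do rewrite big_split/=.
  rewrite big_split/= sumr_const -[X in _ <= X + _]mulr_natl mulr_sumr lerD2l.
  apply: ler_sum => s sS; apply: le_trans (ler_sum _ (fun i _ => IHs s i sS)) _.
  by rewrite (exchange_big_dep predT).
rewrite mulr_sumr mulr_natl -sumr_const; apply: ler_sum => s sS.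
by apply: ler_sum => j _; rewrite colsum.
Qed.

(** * Logarithms of factorials and binomials *)

(* That is, [(1 + 1/n) ^+ n] is nondecreasing; this is AM-GM for [n] copies of
   [1 + 1/n] and one copy of [1], whose mean is [mu]. *)
Lemma ln_ratio_le {R : realType} (n : nat) : (0 < n)%N ->
  n%:R * (ln n.+1%:R - ln n%:R) <= n.+1%:R * (ln n.+2%:R - ln n.+1%:R) :> R.
Proof.
move=> n0; have np : 0 < n%:R :> R by rewrite ltr0n.
have n2 : n.+2%:R = n%:R + 2 :> R by rewrite -addn2 natrD.
have n1 : n.+1%:R = n%:R + 1 :> R by rewrite -addn1 natrD.
have p1 : 0 < n.+1%:R :> R by rewrite ltr0n.
have p2 : 0 < n.+2%:R :> R by rewrite ltr0n.
pose x : R := n.+1%:R / n%:R; pose mu : R := n.+2%:R / n.+1%:R.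
have x0 : 0 < x by rewrite divr_gt0.
have mu0 : 0 < mu by rewrite divr_gt0.
have h1 := ln_le_sub1 (x / mu) (divr_gt0 x0 mu0).
have h2 := ln_le_sub1 mu^-1 ltac:(by rewrite invr_gt0).
have := ler_wpM2l (ltW np) h1.
rewrite ln_div ?posrE// in h2 * => h1'.
rewrite lnV ?posrE// in h2.
have e1 : ln x = ln n.+1%:R - ln n%:R by rewrite ln_div ?posrE.
have e2 : ln mu = ln n.+2%:R - ln n.+1%:R by rewrite ln_div ?posrE.
rewrite -e1 -e2 {1}n1.
have : n%:R * (x / mu - 1) + (mu^-1 - 1) = 0.
  rewrite /x /mu n1 n2; field; lra.
move: h1' h2; move: (ln x) (ln mu) => a b; rewrite ?n1; lra.
Qed.

(** With denominators cleared, this says that [(n!)^(1/n) / n] does not increase from [n] to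
    [n + 1]. The induction step adds [n + 1] times [ln_ratio_le], for the new [n]. *)
Lemma ln_fact_ge {R : realType} (n : nat) : (0 < n)%N ->
  n%:R * ln n.+1%:R - ln n`!%:R <= n%:R * n.+1%:R * (ln n.+1%:R - ln n%:R) :> R.
Proof.
case: n => // n _; elim: n => [|n IH].
  have -> : 1`! = 1%N by [].
  by rewrite ln1; have : 0 <= ln 2%:R :> R by [rewrite ln_ge0// ler1n]; lra.
have p0 : 0 < n.+1%:R :> R by rewrite ltr0n.
have p1 : 0 < n.+2%:R :> R by rewrite ltr0n.
rewrite factS natrM lnM ?posrE ?ltr0n ?fact_gt0//.
have := @ln_ratio_le R n.+1 isT; move: IH.
have n3 : n.+3%:R = n.+1%:R + 2 :> R by rewrite -addn2 natrD.
have n2 : n.+2%:R = n.+1%:R + 1 :> R by rewrite -addn1 natrD.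
move: (ln n.+3%:R) (ln n.+2%:R) (ln n.+1%:R) (ln n.+1`!%:R) => a b c d.
rewrite n3 n2; move: n.+1%:R p0 => x x0 IH.
move=> /(ler_wpM2l (ltW (addr_gt0 x0 ltr01))); lra.
Qed.

Lemma ln_fact_avg_mono {R : realType} (m n : nat) : (0 < m <= n)%N ->
  ln_fact_avg n - ln n%:R <= ln_fact_avg m - ln m%:R :> R.
Proof.
move=> /andP[m0 /subnK <-]; elim: (n - m)%N => // k IH.
apply: le_trans IH; set j := (k + m)%N; have j0 : (0 < j)%N by rewrite addn_gt0 m0 orbT.
rewrite addSn -/j; have jp : 0 < j%:R :> R by rewrite ltr0n.
have j1 : 0 < j.+1%:R :> R by rewrite ltr0n.
have := @ln_fact_ge R j j0.
rewrite /ln_fact_avg factS natrM lnM ?posrE ?ltr0n ?fact_gt0// => h.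
rewrite -(ler_pM2l (mulr_gt0 jp j1)) -subr_ge0.
rewrite [leRHS](_ : _ = j%:R * j.+1%:R * (ln j.+1%:R - ln j%:R)
  - (j%:R * ln j.+1%:R - ln j`!%:R)); first by rewrite subr_ge0.
have -> : j.+1%:R = j%:R + 1 :> R by rewrite -addn1 natrD.
by field; rewrite !gt_eqF// addr_gt0.
Qed.

(** The net cost of padding: [m] all-ones rows contribute [(n!)^(m/n)] to Bregman's bound, and [m!]
    is divided out as the number of extensions of one matching. *)
Lemma ln_fact_pad {R : realType} (m n : nat) : (m <= n)%N ->
  m%:R * ln_fact_avg n - ln m`!%:R <= - (m%:R * ln (m%:R / n%:R)) :> R.
Proof.
case: (posnP m) => [-> _|m0 mn].
  by rewrite !mul0r fact0 ln1 subr0 oppr0.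
have n0 := leq_trans m0 mn.
rewrite ln_div ?posrE ?ltr0n// -ln_fact_avgE -mulrBr -[leRHS]mulrN.
apply: ler_wpM2l => //; have := @ln_fact_avg_mono R m n ltac:(by rewrite m0); lra.
Qed.

(** The alternative [n = 0] covers [0 ^ 0 = 1], which occurs for empty and for perfect matchings. *)
Lemma lnX_nat {R : realType} (x : R) n : ((n == 0)%N || (0 < x)) ->
  ln (x ^+ n) = n%:R * ln x.
Proof.
by case: n => [|n] /= x0; [rewrite expr0 ln1 mul0r | rewrite lnXn// mulr_natl].
Qed.

(** A single term of the binomial expansion of [(q' + q) ^ n = 1] is at most 1. *)
Lemma ln_bin_le {R : realType} (l n : nat) : (0 < n)%N -> (l <= n)%N ->
  ln 'C(n, l)%:R <= - (l%:R * ln (l%:R / n%:R))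
    - (n - l)%:R * ln ((n - l)%:R / n%:R) :> R.
Proof.
move=> n0 le_ln; have np : 0 < n%:R :> R by rewrite ltr0n.
pose q : R := l%:R / n%:R; pose q' : R := (n - l)%:R / n%:R.
have q0 : 0 <= q by rewrite divr_ge0.
have q'0 : 0 <= q' by rewrite divr_ge0.
have qq : q' + q = 1 by rewrite -mulrDl -natrD subnK// divff ?gt_eqF.
have hq : (l == 0)%N || (0 < q).
  by case: posnP => //= l0; rewrite divr_gt0 ?ltr0n.
have hq' : (n - l == 0)%N || (0 < q').
  by case: posnP => //= l0; rewrite divr_gt0 ?ltr0n.
have ppos (x : R) k : ((k == 0)%N || (0 < x)) -> 0 < x ^+ k.
  by case: k => [|k]/= x0; rewrite ?expr0 ?exprn_gt0.
have : q' ^+ (n - l) * q ^+ l *+ 'C(n, l) <= 1.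
  rewrite -(expr1n _ n) -qq exprDn (bigD1 (Ordinal (le_ln : l < n.+1)%N))//= lerDl.
  by apply: sumr_ge0 => i _; rewrite mulrn_wge0// mulr_ge0// exprn_ge0.
have C0 : 0 < 'C(n, l)%:R :> R by rewrite ltr0n bin_gt0.
have Q0 := mulr_gt0 (ppos _ _ hq') (ppos _ _ hq).
rewrite -(mulr_natr (_ * _)) => h.
have : ln (q' ^+ (n - l) * q ^+ l * 'C(n, l)%:R) <= ln 1.
  by rewrite ler_ln ?posrE// mulr_gt0.
rewrite lnM ?posrE// lnM ?posrE ?ppos// !lnX_nat// ln1 -/q -/q'; lra.
Qed.

(** On the negative axis the function vanishes because [ln] does. At 0 it is squeezed by [2 sqrt y],
    which comes from [ln t <= t - 1] at [t = 1 / sqrt y]. *)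
Lemma continuous_xlnx {R : realType} : continuous (fun x : R => x * ln x).
Proof.
move=> x; have [x0|x0|<-] := ltgtP 0 x.
- by apply: cvgM; [exact: cvg_id|exact: continuous_ln].
- apply: (@cvg_trans _ ((fun=> 0 : R) @ x)).
    apply: near_eq_cvg; near=> y; rewrite ln0 ?mulr0//.
    by near: y; apply: filterS (lt_nbhsl x0) => y /ltW.
  have -> : x * ln x = 0 by rewrite ln0 ?mulr0// ltW.
  exact: (@cvg_cst R 0 R (nbhs x) _).
- rewrite /continuous_at mul0r.
  have sq0 : (fun y : R => 2 * Num.sqrt y) @ (0 : R) --> (0 : R).
    have := @sqrt_continuous R 0; rewrite /continuous_at sqrtr0 => h.
    have := cvgM (@cvg_cst R 2 R (nbhs 0) _) h; rewrite mulr0; exact.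
  apply: norm_cvg0; apply: squeeze_cvgr (cvg_cst 0) sq0.
  near=> y; rewrite normr_ge0/=.
  have [y0|y0] := leP y 0; first by rewrite ln0// mulr0 normr0 mulr_ge0.
  have y1 : y < 1 by near: y; exact: lt_nbhsl.
  rewrite normrM gtr0_norm// ltr0_norm ?ln_lt0 ?y0//.
  have s0 : 0 < Num.sqrt y by rewrite sqrtr_gt0.
  have yE : y = Num.sqrt y ^+ 2 by rewrite sqr_sqrtr ?ltW.
  have h := ln_le_sub1 (Num.sqrt y)^-1 ltac:(by rewrite invr_gt0).
  rewrite lnV ?posrE// in h.
  rewrite {1 2}yE lnXn//.
  have := ler_wpM2l (ltW (exprn_gt0 2 s0)) h.
  rewrite mulrBr mulr1 expr2 -[X in _ <= X - _]mulrA divff ?gt_eqF//.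
  move: (Num.sqrt y) s0 (ln _) => s s0 b h'; nra.
Unshelve. all: by end_near. Qed.

(** * Counting matchings *)

(** The complements of [X] and of its image have the same size, so their enumerations can be matched
    position by position. *)
Lemma inj_in_extend_perm (T : finType) (X : {set T}) (f : T -> T) :
  {in X &, injective f} -> exists s : {perm T}, {in X, f =1 s}.
Proof.
move=> f_inj; pose Y := (f @: X)%SET.
have szY : size (enum (~: X)%SET) = size (enum (~: Y)%SET).
  by rewrite -!cardE [LHS]cardsCs [RHS]cardsCs !finset.setCK card_in_imset.
pose g x := if x \in X then f x else nth x (enum (~: Y)%SET) (index x (enum (~: X)%SET)).
have gX x : x \in X -> g x = f x by rewrite /g => ->.
have idx x : x \notin X -> (index x (enum (~: X)%SET) < size (enum (~: Y)%SET))%N.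
  by move=> xX; rewrite -szY index_mem mem_enum inE.
have gY x : (g x \in Y) = (x \in X).
  rewrite /g; case: ifPn => xX; first by rewrite imset_f.
  by apply/negbTE; rewrite -finset.in_setC -mem_enum mem_nth// idx.
have g_inj : injective g.
  move=> x y gxy; have := gY x; rewrite gxy gY; case: (boolP (x \in X)) => xX yX.
    by apply: f_inj => //; rewrite -!gX.
  move: gxy; rewrite /g (negbTE xX) yX => /eqP.
  have yX' : y \notin X by rewrite yX.
  rewrite (set_nth_default y) ?idx// nth_uniq ?idx ?enum_uniq// => /eqP.
  move=> /(congr1 (nth x (enum (~: X)%SET))).
  by rewrite !nth_index ?mem_enum ?inE.
by exists (perm g_inj) => x xX; rewrite permE gX.
Qed.

Lemma card_bigcup_le (I T : finType) (P : pred I) (F : I -> {set T}) :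
  (#|(\bigcup_(i | P i) F i)%SET| <= \sum_(i | P i) #|F i|)%N.
Proof.
elim/big_rec2: _ => [|i n U _ leUn]; first by rewrite cards0.
by rewrite (leq_trans (leq_card_setU _ _).1)// leq_add2l.
Qed.

Definition edge_set {V : finType} {n} (e : 'I_n -> 'I_n -> {set V})
    (X : {set 'I_n}) (f : {ffun 'I_n -> 'I_n}) : {set {set V}} :=
  [set e i (f i) | i in X]%SET.

(** Fixing [f i = i] outside [X] represents each partial injection on [X] by exactly one total
    function. *)
Definition partial_inj {n} (a : rel 'I_n) (X : {set 'I_n}) : {set {ffun 'I_n -> 'I_n}} :=
  [set f : {ffun 'I_n -> 'I_n} |
     dinjectiveb f [in X] & [forall i, if i \in X then a i (f i) else f i == i]]%SET.

(** Forgetting injectivity leaves [r] choices at each index of [X] and one elsewhere. *)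
Lemma card_edge_set_expn {V : finType} {n r} (e : 'I_n -> 'I_n -> {set V})
    (a : rel 'I_n) (X : {set 'I_n}) :
  (forall i, #|[set k | a i k]%SET| = r) ->
  (#|(edge_set e X @: partial_inj a X)%SET| <= r ^ #|X|)%N.
Proof.
move=> ar; apply: leq_trans (leq_imset_card _ _) _.
pose F (i : 'I_n) : pred 'I_n := if i \in X then a i else pred1 i.
apply: (@leq_trans #|(family F : simpl_pred {ffun 'I_n -> 'I_n})|).
  apply: subset_leq_card; apply/fintype.subsetP => f; rewrite inE => /andP[_ /forallP fa].
  by apply/familyP => i; have := fa i; rewrite /F unfold_in; case: ifP.
rewrite card_family foldrE big_map big_enum/= (bigID [in X])/= [X in (_ * X)%N]big1 ?muln1.
  rewrite -prod_nat_const; apply: leq_prod => i iX.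
  by rewrite -(ar i) /F iX subset_leq_card//; apply/fintype.subsetP => k; rewrite inE.
by move=> i /negbTE iX; rewrite /F iX card1.
Qed.

(** The rows outside [X] become all-ones rows, which keeps the matrix square. *)
Definition pad {n} (a : rel 'I_n) (X : {set 'I_n}) : rel 'I_n :=
  fun i k => (i \notin X) || a i k.

(* Precomposing one permutation extending a matching of [X] with the
   permutations supported outside [X] gives [(n - #|X|)`!] distinct ones that
   induce the same matching. *)
Lemma card_edge_set_perms {V : finType} {n} (e : 'I_n -> 'I_n -> {set V})
    (a : rel 'I_n) (X : {set 'I_n}) :
  (#|(edge_set e X @: partial_inj a X)%SET| * (n - #|X|)`! <= #|perms (pad a X)|)%N.
Proof.
pose mk (s : 'S_n) := edge_set e X [ffun i => s i].
have mkP M : M \in (edge_set e X @: partial_inj a X)%SET ->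
    exists2 s, s \in perms (pad a X) & mk s = M.
  move=> /imsetP[f]; rewrite inE => /andP[/dinjectiveP finj /forallP fa] ->.
  have [s sf] := @inj_in_extend_perm _ X f finj; exists s.
    rewrite inE; apply/forallP => i; have := fa i; rewrite /pad.
    by case: ifP => //= iX; rewrite -sf.
  by apply: eq_in_imset => i iX; rewrite ffunE -sf.
pose g M := odflt (1%g : 'S_n) [pick s in perms (pad a X) | mk s == M].
have gP M : M \in (edge_set e X @: partial_inj a X)%SET ->
    g M \in perms (pad a X) /\ mk (g M) = M.
  move=> /mkP[s sP sM]; rewrite /g; case: pickP => [s' /andP[? /eqP]//|/(_ s)].
  by rewrite sP sM eqxx.
have -> : (n - #|X|)`! = #|perm_on (~: X)%SET|.
  by rewrite card_perm [in RHS]cardsCs finset.setCK card_ord.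
have <- : #|[set t : 'S_n | perm_on (~: X)%SET t]%SET| = #|perm_on (~: X)%SET|.
  by apply: eq_card => t; rewrite !inE.
rewrite -cardsX; set D := finset.setX _ _.
(* The product applies [u.2] first. As [u.2] fixes [X], the induced matching is unchanged, so it
   determines [u.1], and then [u.2] by cancellation. *)
pose h (u : {set {set V}} * 'S_n) : 'S_n := (u.2 * g u.1)%g.
have tX (t : 'S_n) i : perm_on (~: X)%SET t -> i \in X -> t i = i.
  by move=> tX iX; apply: out_perm tX _; rewrite inE iX.
have mkh u : perm_on (~: X)%SET u.2 -> mk (h u) = mk (g u.1).
  by move=> tu; apply: eq_in_imset => i iX; rewrite !ffunE permM (tX u.2).
have h_inj : {in D &, injective h}.
  move=> [M t] [M' t']; rewrite !inE/= => /andP[/gP[_ gM] tP] /andP[/gP[_ gM'] tP'] hh.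
  have MM' : M = M' by have := congr1 mk hh; rewrite !mkh//= gM gM'.
  by move: hh; rewrite /h/= MM' => /mulIg ->.
rewrite -(card_in_imset h_inj).
apply: subset_leq_card; apply/fintype.subsetP => s /imsetP[[M t] + ->].
rewrite !inE/= => /andP[/gP[gs _] tP]; move: gs; rewrite inE => /forallP gs.
apply/forallP => i; rewrite /h/= permM.
have := gs (t i); rewrite /pad; case: (boolP (i \in X)) => //= iX.
by rewrite tX// iX.
Qed.

(** Both sides are labelled by the same ['I_n], so that [side_adj] is a square biadjacency
    matrix. *)
Definition sides {G : simple_graph} {n} (al be : 'I_n -> G) : Prop :=
  [/\ injective al, injective be, forall i j, al i != be j &
      forall m, m \in edges G -> exists i j, m = [set al i; be j]%SET].

Definition side_edge {G : simple_graph} {n} (al be : 'I_n -> G) (i j : 'I_n) : {set G} :=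
  [set al i; be j]%SET.

Definition side_adj {G : simple_graph} {n} (al be : 'I_n -> G) : rel 'I_n :=
  fun i j => side_edge al be i j \in edges G.

Lemma side_edge_inj {G : simple_graph} {n} {al be : 'I_n -> G} {i j i' j'} :
  sides al be -> side_edge al be i j = side_edge al be i' j' -> i = i' /\ j = j'.
Proof.
move=> [al_inj be_inj ab _] E; split.
  apply: al_inj; apply/eqP; have := set21 (al i) (be j).
  by rewrite -/(side_edge al be i j) E !inE (negbTE (ab i j')) orbF.
apply: be_inj; apply/eqP; have := set22 (al i) (be j).
by rewrite -/(side_edge al be i j) E !inE eq_sym (negbTE (ab i' j)).
Qed.

Lemma card_side_adj {G : simple_graph} {n} (al be : 'I_n -> G) i :
  sides al be -> #|[set j | side_adj al be i j]%SET| = degree (al i).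
Proof.
move=> S; rewrite -(@card_in_imset _ _ (side_edge al be i)); last first.
  by move=> j j' _ _ /(side_edge_inj S)[].
have [al_inj be_inj ab cov] := S.
apply: eq_card => m; rewrite inE; apply/imsetP/andP => [[j + ->]|[mE im]].
  by rewrite inE => ij; split; [exact: ij|exact: set21].
have [i' [j mij]] := cov m mE; move: im; rewrite mij !inE (negbTE (ab _ _)) orbF.
by move=> /eqP/al_inj ->; exists j => //; rewrite inE /side_adj /side_edge -mij.
Qed.

(** [X] is the set of [al]-vertices covered by [M], and [f] sends each of them to its partner. *)
Lemma matching_edge_set {G : simple_graph} {n} {al be : 'I_n -> G} {M : {set {set G}}} :
  sides al be -> is_matching M -> exists2 X : {set 'I_n}, #|X| = #|M| &
    M \in (edge_set (side_edge al be) X @: partial_inj (side_adj al be) X)%SET.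
Proof.
move=> S /andP[/fintype.subsetP ME /finset.trivIsetP Mtriv].
have [al_inj be_inj ab cov] := S; set e := side_edge al be.
have Meq x m m' : m \in M -> m' \in M -> x \in m -> x \in m' -> m = m'.
  move=> mM mM' xm xm'; apply/eqP/negPn/negP => /(Mtriv _ _ mM mM').
  by move=> /disjointFr/(_ xm); rewrite xm'.
pose X := [set i | [exists j, e i j \in M]]%SET.
(* Outside [X] the default [i] is the value prescribed by [partial_inj]. *)
pose f := [ffun i => odflt i [pick j | e i j \in M]].
have fX i : i \in X -> e i (f i) \in M.
  rewrite inE => /existsP[j ij]; rewrite ffunE; case: pickP => //= /(_ j).
  by rewrite ij.
have Mf : edge_set e X f = M.
  apply/setP => m; apply/imsetP/idP => [[i iX ->]|mM]; first exact: fX.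
  have [i [j mij]] := cov m (ME m mM).
  have iX : i \in X by rewrite inE; apply/existsP; exists j; rewrite /e /side_edge -mij.
  exists i => //; apply: (Meq (al i)) => //; first exact: fX.
    by rewrite mij set21.
  by rewrite set21.
exists X.
  by rewrite -Mf card_in_imset// => i i' _ _ /(side_edge_inj S)[].
rewrite -[M in M \in _]Mf; apply: imset_f; rewrite inE; apply/andP; split.
  apply/dinjectiveP => i i' iX iX' ff.
  have fi : be (f i) \in e i' (f i') by rewrite ff set22.
  have := Meq _ _ _ (fX i iX) (fX i' iX') (set22 _ _) fi.
  by move=> /(side_edge_inj S)[].
apply/forallP => i; case: ifPn => iX; first exact/ME/fX.
rewrite ffunE; case: pickP => //= j ij; case/negP: iX.
by rewrite inE; apply/existsP; exists j.
Qed.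

(** Matchings are sorted by the [l]-subset they cover on the [al] side; [K] is left open to receive
    both the power bound and Bregman's. *)
Lemma phi_le_bin {G : simple_graph} {n} (al be : 'I_n -> G) (l K : nat) :
  sides al be ->
  (forall X : {set 'I_n}, #|X| = l ->
    (#|(edge_set (side_edge al be) X @: partial_inj (side_adj al be) X)%SET| <= K)%N) ->
  (phi l G <= 'C(n, l) * K)%N.
Proof.
move=> S XK; apply: (@leq_trans #|(\bigcup_(X : {set 'I_n} | #|X| == l)
    (edge_set (side_edge al be) X @: partial_inj (side_adj al be) X))%SET|).
  apply: subset_leq_card; apply/fintype.subsetP => M; rewrite inE => /andP[Mm /eqP Ml].
  have [X XM MX] := matching_edge_set S Mm.
  by apply/bigcupP; exists X => //; rewrite XM Ml.
apply: leq_trans (card_bigcup_le _ _ _ _) _.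
apply: (@leq_trans (\sum_(X : {set 'I_n} | #|X| == l) K)%N).
  by apply: leq_sum => X /eqP; exact: XK.
rewrite sum_nat_const -[n in 'C(n, l)]card_ord -card_draws leq_mul2r orbC.
by rewrite subset_leq_card//; apply/fintype.subsetP => X; rewrite inE.
Qed.

(** Double counting of the incidences between [A] and the edges. *)
Lemma sum_degree {G : simple_graph} {A : {set G}} {k} :
  (forall m, m \in edges G -> #|A :&: m|%SET = k) ->
  (\sum_(v in A) degree v = #|edges G| * k)%N.
Proof.
move=> Ak; rewrite -sum_nat_const.
under eq_bigr do rewrite /degree -sum1dep_card.
rewrite (exchange_big_dep (fun m => m \in edges G))/=; last by move=> v m _ /andP[].
apply: eq_bigr => m mE; rewrite sum1dep_card -(Ak m mE).
by apply: eq_card => v; rewrite !inE mE.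
Qed.

Lemma bipartite_sides {G : simple_graph} r : (0 < r)%N ->
  is_regular r G -> is_bipartite G ->
  exists n (al be : 'I_n -> G), #|G| = (2 * n)%N /\ sides al be.
Proof.
move=> r0 reg [A bip].
have A1 m : m \in edges G -> exists x y, [/\ x \in A, y \notin A & m = [set x; y]%SET].
  move=> mE; have /bip[] := mE.
  have /eqP/cards2P[x [y [xy ->]]] := card_edge mE.
  rewrite !finset.subUset !finset.sub1set !inE.
  case xA : (x \in A); case yA : (y \in A) => //= _ _.
    by exists x, y; rewrite xA yA.
  by exists y, x; rewrite xA yA finset.setUC.
have cA m : m \in edges G -> #|A :&: m|%SET = 1%N.
  move=> /A1[x [y [xA yA ->]]]; apply/eqP/cards1P; exists x; apply/setP => z.
  rewrite !inE; case: eqP => [->|_]; first by rewrite xA.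
  by case: eqP => [->|_]; rewrite ?(negbTE yA) ?andbF.
have cB m : m \in edges G -> #|~: A :&: m|%SET = 1%N.
  move=> /A1[x [y [xA yA ->]]]; apply/eqP/cards1P; exists y; apply/setP => z.
  rewrite !inE; case: (eqVneq z y) => [->|_]; first by rewrite yA orbT.
  by case: eqP => [->|_]; rewrite ?xA ?andbF.
(* Each edge has one end in each class, so both classes have [#|edges G| / r] vertices. *)
have AB : #|(~: A)%SET| = #|A|.
  apply/eqP; rewrite -(eqn_pmul2r r0) -!sum_nat_const; apply/eqP.
  have := sum_degree cA; have := sum_degree cB.
  by under eq_bigr do rewrite reg; move=> ->; under eq_bigr do rewrite reg; move=> ->.
exists #|A|, (fun i => enum_val i), (fun j => enum_val (cast_ord (esym AB) j)); split.
  by rewrite -(cardsC A) AB addnn -mul2n.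
split=> [|i j /enum_val_inj/cast_ord_inj//|i j|m /A1[x [y [xA yA ->]]]].
- exact: enum_val_inj.
- apply/eqP => E; have := enum_valP i; rewrite E.
  by have := enum_valP (cast_ord (esym AB) j); rewrite inE => /negbTE ->.
- have yA' : y \in (~: A)%SET by rewrite inE.
  exists (enum_rank_in xA x), (cast_ord AB (enum_rank_in yA' y)).
  by rewrite cast_ordK !enum_rankK_in.
Qed.

(** * Passage to the limit *)

Lemma ln_card_perms_pad {R : realType} {n r} (a : rel 'I_n) (X : {set 'I_n}) :
  (forall i, #|[set k | a i k]%SET| = r) -> (0 < #|perms (pad a X)|)%N ->
  ln #|perms (pad a X)|%:R
  <= #|X|%:R * ln_fact_avg r + (n - #|X|)%:R * ln_fact_avg n :> R.
Proof.
move=> ar P0; apply: le_trans (bregman _ _ P0) _.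
rewrite (bigID [in X])/=.
rewrite (eq_bigr (fun=> ln_fact_avg r)); last first.
  move=> i iX; rewrite -(ar i); congr ln_fact_avg; apply: eq_card => k.
  by rewrite !inE /pad iX.
rewrite (eq_bigr (fun=> ln_fact_avg n) (P := fun i => i \notin X)); last first.
  move=> i iX; congr ln_fact_avg; rewrite -[RHS]card_ord; apply: eq_card => k.
  by rewrite !inE /pad iX.
rewrite (eq_bigl [in ~: X]%SET); last by move=> i; rewrite !inE.
by rewrite !sumr_const -2!(mulr_natl (ln_fact_avg _)) cardsCs finset.setCK card_ord.
Qed.

Lemma ln_phi_le_upp {R : realType} {G : simple_graph} {n r l}
    {al be : 'I_n -> G} : (0 < r)%N -> (0 < n)%N ->
  sides al be -> is_regular r G -> (0 < phi l G)%N ->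
  let q : R := l%:R / n%:R in
  ln (phi l G)%:R <= (2 * n)%:R * upp1 r q /\
  ln (phi l G)%:R <= (2 * n)%:R * upp2 r q.
Proof.
move=> r0 n0 S reg phi0 q; pose a := side_adj al be.
have ar i : #|[set k | a i k]%SET| = r by rewrite card_side_adj.
(* For [l > n] the binomial bound would give [phi l G = 0]. *)
have ln_le : (l <= n)%N.
  rewrite leqNgt; apply: contraL phi0 => nl; rewrite -leqNgt.
  apply: leq_trans (phi_le_bin _ _ l (r ^ l) S _) _; last by rewrite bin_small.
  by move=> X <-; apply: card_edge_set_expn.
have np : 0 < n%:R :> R by rewrite ltr0n.
have rp : 0 < r%:R :> R by rewrite ltr0n.
have lq : l%:R = n%:R * q by rewrite mulrC divfK ?gt_eqF.
have nlq : (n - l)%:R = n%:R * (1 - q) :> R by rewrite natrB// lq; ring.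
have nlq' : (n - l)%:R / n%:R = 1 - q :> R by rewrite nlq mulrC mulKf ?gt_eqF.
have C0 : 0 < 'C(n, l)%:R :> R by rewrite ltr0n bin_gt0.
have phip : 0 < (phi l G)%:R :> R by rewrite ltr0n.
have lnC := @ln_bin_le R l n n0 ln_le.
have bound K : (forall X : {set 'I_n}, #|X| = l ->
     (#|(edge_set (side_edge al be) X @: partial_inj a X)%SET| <= K)%N) ->
   ln (phi l G)%:R <= ln 'C(n, l)%:R + ln K%:R :> R /\ (0 < K)%N.
  move=> /(phi_le_bin _ _ _ _ S) h.
  have K0 : (0 < K)%N.
    by rewrite lt0n; apply: contraTneq phi0 => K0; move: h; rewrite K0 muln0 leqn0 => /eqP ->.
  have Kp : 0 < K%:R :> R by rewrite ltr0n.
  by split=> //; rewrite -lnM ?posrE// ler_ln ?posrE ?mulr_gt0// -natrM ler_nat.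
split.
  (* [E] is Bregman's bound for the padded matrix; the quotient by [(n - l)!] is truncated because
     [bound] takes a natural number. *)
  pose E : R := expR (l%:R * ln_fact_avg r + (n - l)%:R * ln_fact_avg n).
  have F0 : 0 < (n - l)`!%:R :> R by rewrite ltr0n fact_gt0.
  have E0 : 0 < E / (n - l)`!%:R by rewrite divr_gt0// expR_gt0.
  have [X Xl|h K0] := bound (Num.truncn (E / (n - l)`!%:R)).
    rewrite (truncn_ge_nat _ (ltW E0)) ler_pdivlMr//.
    have := card_edge_set_perms (side_edge al be) a X; rewrite Xl -(ler_nat R) natrM.
    move=> /le_trans; apply.
    have [->|P0] := posnP #|perms (pad a X)|; first exact: expR_ge0.
    rewrite -ler_ln ?posrE ?ltr0n ?expR_gt0// expRK -Xl.
    exact: ln_card_perms_pad.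
  have hK : ln (Num.truncn (E / (n - l)`!%:R))%:R <= ln (E / (n - l)`!%:R).
    by rewrite ler_ln ?posrE ?ltr0n// truncn_le ltW.
  rewrite ln_div ?posrE ?expR_gt0// expRK in hK.
  have := @ln_fact_pad R (n - l) n (leq_subr _ _).
  (* The term [(n - l) ln (1 - q)] occurs twice: once from the binomial coefficient, once from the
     padding. *)
  have -> : (2 * n)%:R * upp1 r q = - (l%:R * ln q) - 2 * ((n - l)%:R * ln (1 - q))
      + l%:R * ln_fact_avg r.
    by rewrite /upp1 /ln_fact_avg natrM lq nlq; field; rewrite gt_eqF.
  move: lnC; rewrite nlq' -/q; lra.
have [X Xl|h _] := bound (r ^ l)%N.
  by rewrite -Xl; apply: card_edge_set_expn.
rewrite natrX lnX_nat ?rp ?orbT// in h.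
have -> : (2 * n)%:R * upp2 r q = - (l%:R * ln q) - (n - l)%:R * ln (1 - q)
      + l%:R * ln r%:R.
  by rewrite /upp2 natrM lq nlq; field.
move: lnC; rewrite nlq' -/q; lra.
Qed.

(** The finite bound holds at the actual density of [l n], which tends to [p]; continuity of [f]
    carries it to the limit. *)
Lemma matching_entropy_le {R : realType} (G : nat -> simple_graph) (p : R) (f : R -> R) :
  {for p, continuous f} ->
  (fun n => #|G n|) @ \oo --> \oo ->
  (forall n l, (0 < #|G n|)%N -> (0 < phi l (G n))%N ->
    ln (phi l (G n))%:R <= #|G n|%:R * f ((2 * l)%:R / #|G n|%:R)) ->
  (matching_entropy G p <= (f p)%:E)%E.
Proof.
move=> fp Goo fle; apply: ge_ereal_sup => _ [l lp <-].
(* The upper limit is an infimum of suprema over sets in the filter [\oo], so one such set [V]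
   suffices for each [e]. *)
apply/lee_addgt0Pr => e e0; apply: ereal_inf_le.
have fl : (fun n => f ((2 * l n)%:R / #|G n|%:R)) @ \oo --> f p.
  by apply: continuous_cvg.
pose V := [set n | (0 < #|G n|)%N /\ f ((2 * l n)%:R / #|G n|%:R) < f p + e].
have VF : \oo V.
  near=> n; split; near: n.
    by move/cvgnyPgt: Goo; apply.
  by apply: (cvgr_lt _ fl); rewrite ltrDl.
exists (ereal_sup ((fun n => (lne (phi (l n) (G n))%:R%:E / (#|G n|%:R : R)%:E)%E) @` V)).
  by exists V.
apply: ge_ereal_sup => _ [n [n0 nlt] <-].
have Np : 0 < #|G n|%:R :> R by rewrite ltr0n.
(* Where there are no matchings the quotient is [-oo], and the bound is trivial. *)
rewrite inver gt_eqF//; have [->|phi0] := posnP (phi (l n) (G n)).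
  by rewrite le0_lneNy// gt0_mulNye ?leNye// lte_fin invr_gt0.
rewrite lne_EFin ?ltr0n// -EFinM -EFinD lee_fin ler_pdivrMr//.
by rewrite (le_trans (fle _ _ n0 phi0))// mulrC ler_pM2r// ltW.
Unshelve. all: by end_near. Qed.

Lemma continuous_xlnx_compl {R : realType} : continuous (fun x : R => (1 - x) * ln (1 - x)).
Proof.
move=> x; apply: (@continuous_comp R R R (fun x => 1 - x) (fun x => x * ln x)).
  by apply: cvgB; [exact: (@cvg_cst R)|exact: cvg_id].
exact: continuous_xlnx.
Qed.

Lemma continuous_upp1 {R : realType} r : continuous (upp1 r : R -> R).
Proof.
move=> p; apply: cvgB; last exact: continuous_xlnx_compl.
apply: cvgB; last by apply: cvgM; [exact: (@cvg_cst R)|exact: continuous_xlnx].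
apply: cvgM; last exact: (@cvg_cst R).
by apply: cvgM; [exact: cvg_id|exact: (@cvg_cst R)].
Qed.

Lemma continuous_upp2 {R : realType} r : continuous (upp2 r : R -> R).
Proof.
move=> p; apply: cvgB; last first.
  apply: cvgM; first exact: (@cvg_cst R).
  by apply: cvgD; [exact: continuous_xlnx|exact: continuous_xlnx_compl].
apply: cvgM; last exact: (@cvg_cst R).
by apply: cvgM; [exact: cvg_id|exact: (@cvg_cst R)].
Qed.

Theorem theorem7p3 (R : realType) (r : nat) (hr : (2 <= r)%N)
    (G : nat -> simple_graph)
    (hreg : forall n, is_regular r (G n))
    (hbip : forall n, is_bipartite (G n))
    (hcard : (fun n => #|G n|) @ \oo --> \oo)
    (p : R) (hp : 0 <= p <= 1) :
  (matching_entropy G p <= (Num.min (upp1 r p) (upp2 r p))%:E)%E.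
Proof.
have r0 : (0 < r)%N by exact: ltnW.
have bound n l : (0 < #|G n|)%N -> (0 < phi l (G n))%N ->
    let q : R := (2 * l)%:R / #|G n|%:R in
    ln (phi l (G n))%:R <= #|G n|%:R * upp1 r q /\
    ln (phi l (G n))%:R <= #|G n|%:R * upp2 r q.
  move=> n0 phi0; have [m [al [be [mE S]]]] := bipartite_sides r r0 (hreg n) (hbip n).
  have m0 : (0 < m)%N by move: n0; rewrite mE muln_gt0.
  (* Since [#|G n| = 2 m], the vertex density [2 l / #|G n|] is the fraction [l / m] of one side. *)
  have -> : (2 * l)%:R / #|G n|%:R = l%:R / m%:R :> R.
    by rewrite mE !natrM -mulf_div divff ?mul1r ?pnatr_eq0.
  by rewrite mE; exact: (ln_phi_le_upp r0 m0 S (hreg n) phi0).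
rewrite EFin_min le_min; apply/andP; split; apply: matching_entropy_le => //.
- exact: continuous_upp1.
- by move=> n l n0 phi0; have [] := bound n l n0 phi0.
- exact: continuous_upp2.
- by move=> n l n0 phi0; have [] := bound n l n0 phi0.
Qed.
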